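(* Let $f$ be a real polynomial and $X=\{(x,y): y\le f(x)\}$. There exists a cell decomposition of $X$ such that for any two points $A,B\in X$ and any shortest-length curve $\gamma$ from $A$ to $B$ in $X$, $\gamma$ interacts with each cell at most finitely many times, and with each $0$-cell and each $1$-cell at most twice.
   Context: A shortest-length curve from $A$ to $B$ in a set $X\subseteq\mathbb{R}^2$ is a continuous piecewise $C^2$ curve $\gamma:[a,b]\to X$ with $\gamma(a)=A$, $\gamma(b)=B$ whose length $\int_a^b|\gamma'|$ is minimal among all piecewise $C^2$ curves in $X$ from $A$ to $B$. A cell decomposition of $X\subseteq\mathbb{R}^2$ is a partition of $X$ into at most countably many pairwise disjoint subsets (cells), each homeomorphic to $\mathbb{R}^d$ for some $d\in\{0,1,2\}$ (a $d$-cell), such that the closure of each cell meets only finitely many cells. A curve $\gamma:[a,b]\to\mathbb{R}^2$ interacts with a set $e$ at most $N$ times if $\gamma^{-1}(e)$ has at most $N$ connected components. *)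

(* Defs.v *)
From HB Require Import structures.
From mathcomp Require Import all_boot all_order all_algebra.
From mathcomp Require Import all_classical all_reals all_analysis.
Set Implicit Arguments. Unset Strict Implicit. Unset Printing Implicit Defensive.
Import Order.TTheory GRing.Theory Num.Theory.
Import numFieldNormedType.Exports.
Local Open Scope classical_set_scope.
Local Open Scope ring_scope.

Section Defs.
Variable R : realType.

Definition is_cell (d : nat) (e : set (R * R)) : Prop :=
  exists (phi : 'rV[R]_d -> R * R) (psi : R * R -> 'rV[R]_d),
    [/\ continuous phi,
        {within e, continuous psi},
        (forall v, e (phi v)),
        (forall v, psi (phi v) = v) &
        (forall p, e p -> phi (psi p) = p)].

Definition cell_decomposition (X : set (R * R)) (C : set (set (R * R))) : Prop :=
  [/\ countable C,
      (forall e, C e -> exists2 d : nat, (d <= 2)%N & is_cell d e),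
      (forall e1 e2, C e1 -> C e2 -> e1 `&` e2 !=set0 -> e1 = e2),
      X = \bigcup_(e in C) e &
      (forall e, C e -> finite_set [set e' | C e' /\ closure e `&` e' !=set0])].

Definition C2fun (u : R -> R) : Prop :=
  [/\ (forall t, derivable u t 1),
      (forall t, derivable (derive1 u) t 1) &
      continuous (derive1 (derive1 u))].

(* g restricted to [a,b] is a continuous piecewise C^2 curve: there is a
   partition a = t_0 < t_1 < ... < t_n = b such that on each closed piece
   [t_i, t_{i+1}] g coincides with a C^2 map (hence g is continuous on [a,b]
   and C^2 up to the endpoints on each piece). *)
Definition piecewise_C2 (g : R -> R * R) (a b : R) : Prop :=
  exists s : seq R,
    [/\ sorted <%R (a :: s), last a s = b &
        forall i, (i < size s)%N ->
          exists h : R -> R * R,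
            [/\ C2fun (fun t => (h t).1), C2fun (fun t => (h t).2) &
                forall t, nth a (a :: s) i <= t <= nth a s i -> h t = g t]].

Definition curve_length (g : R -> R * R) (a b : R) : \bar R :=
  (\int[lebesgue_measure]_(t in `[a, b]%classic)
     (Num.sqrt ((derive1 (fun s => (g s).1) t) ^+ 2
              + (derive1 (fun s => (g s).2) t) ^+ 2))%:E)%E.

Definition curve_in (X : set (R * R)) (A B : R * R) (g : R -> R * R) (a b : R) :=
  [/\ a <= b, piecewise_C2 g a b, (forall t, a <= t <= b -> X (g t)),
      g a = A & g b = B].

Definition shortest_curve (X : set (R * R)) (A B : R * R)
    (g : R -> R * R) (a b : R) : Prop :=
  curve_in X A B g a b /\
  forall (g' : R -> R * R) (a' b' : R), curve_in X A B g' a' b' ->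
    (curve_length g a b <= curve_length g' a' b')%E.

Definition curve_preimage (g : R -> R * R) (a b : R) (e : set (R * R)) : set R :=
  [set t | a <= t <= b /\ e (g t)].

Definition components (S : set R) : set (set R) :=
  connected_component S @` S.

Definition interacts_at_most (g : R -> R * R) (a b : R) (e : set (R * R)) (N : nat) :=
  (components (curve_preimage g a b e) #<= `I_N)%card.

Definition interacts_finitely (g : R -> R * R) (a b : R) (e : set (R * R)) :=
  finite_set (components (curve_preimage g a b e)).

End Defs.

(* Main.v *)
Require Import Defs.
From HB Require Import structures.
From mathcomp Require Import all_boot all_order all_algebra.
From mathcomp Require Import all_classical all_reals all_analysis.
From mathcomp Require Import measurable_realfun polyrcf ring lra.
Set Implicit Arguments. Unset Strict Implicit. Unset Printing Implicit Defensive.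
Import Order.TTheory GRing.Theory Num.Theory.
Import numFieldNormedType.Exports.
Local Open Scope classical_set_scope.
Local Open Scope ring_scope.

(** A shortest curve is taut: whenever the chord between two of its points lies
    in the region, replacing the arc by the chord shows that the arc runs along
    the chord.  Vertical chords always lie in the region, so the abscissa is
    monotone along the curve and every point is visited during one time interval.
    Cut the line at the roots of [f''] and take as cells the boundary points and
    the open vertical rays over the roots, and the boundary arcs and the open
    regions below them over the gaps.  Over a gap with [f'' < 0] a taut curve
    touches the boundary only at its endpoints; over a gap with [f'' >= 0] the
    set of contact times is an interval.  Hence every cell, including the
    2-cells, is met at most twice. *)

(** * Length of smooth curves *)

Section Length.
Variable R : realType.
Implicit Types (g h : R -> R * R) (p q : R * R) (a b s t : R).
Let mu := @lebesgue_measure R.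

(** Minimality enters only through chord replacement; after that the curve is a pair of continuous
    functions of time with the chord property. The obstacle is the parametrization: a piecewise C^2
    curve may pause, so a time close to a contact need not give a different position. Each local
    argument therefore passes to the first or last time at the position (or level) concerned and
    steps off just beyond it. The bound 2 comes from excluding the pattern in, out, in, out, in. Two
    visits do occur: over a convex gap a curve can leave the open region, slide along the arc and
    return, and over a concave gap it can start and end on the arc. The weak inequality f'' >= 0
    also takes in the case f'' = 0, where nothing is cut and the whole line is one gap. *)

Definition speed g t : R :=
  Num.sqrt (derive1 (fun s => (g s).1) t ^+ 2
          + derive1 (fun s => (g s).2) t ^+ 2).

(** Written out because the norm on [R * R] is the maximum norm, while length is Euclidean. *)
Definition edist p q : R :=
  Num.sqrt ((q.1 - p.1) ^+ 2 + (q.2 - p.2) ^+ 2).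

Definition C2curve h := C2fun (fun t => (h t).1) /\ C2fun (fun t => (h t).2).

Lemma speed_ge0 g t : 0 <= speed g t.
Proof. exact: sqrtr_ge0. Qed.

Lemma edist_ge0 p q : 0 <= edist p q.
Proof. exact: sqrtr_ge0. Qed.

Lemma sqr_edist p q :
  edist p q ^+ 2 = (q.1 - p.1) ^+ 2 + (q.2 - p.2) ^+ 2.
Proof. by rewrite sqr_sqrtr// addr_ge0// sqr_ge0. Qed.

Lemma sqr_speed g t : speed g t ^+ 2 =
  derive1 (fun s => (g s).1) t ^+ 2 + derive1 (fun s => (g s).2) t ^+ 2.
Proof. by rewrite sqr_sqrtr// addr_ge0// sqr_ge0. Qed.

(** Lagrange's identity: the defect of the squares is (u y - v x)^2. The norms enter as numbers [d]
    and [e] known by their squares, which keeps square roots away from [nra]. *)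
Lemma cauchy_schwarz2 (u v x y d e : R) : 0 <= d -> 0 <= e ->
  d ^+ 2 = u ^+ 2 + v ^+ 2 -> e ^+ 2 = x ^+ 2 + y ^+ 2 ->
  u * x + v * y <= d * e.
Proof.
move=> d0 e0 hd he; apply: le_trans (ler_norm _) _.
rewrite -(ler_pXn2r (n := 2)) ?nnegrE ?mulr_ge0//.
rewrite real_normK ?num_real// exprMn hd he.
have := sqr_ge0 (u * y - v * x); nra.
Qed.

Lemma edist_triangle p q r : edist p r <= edist p q + edist q r.
Proof.
rewrite -(ler_pXn2r (n := 2)) ?nnegrE ?addr_ge0 ?edist_ge0//.
have := @cauchy_schwarz2 _ _ _ _ _ _ (edist_ge0 p q) (edist_ge0 q r)
  (sqr_edist p q) (sqr_edist q r).
have := sqr_edist p r; have := sqr_edist p q; have := sqr_edist q r.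
nra.
Qed.

Definition on_segment p q r := exists l : R,
  [/\ 0 <= l <= 1, r.1 = (1 - l) * p.1 + l * q.1
    & r.2 = (1 - l) * p.2 + l * q.2].

(** With d = |pr| and e = |rq|, equality in the triangle inequality forces equality in
    Cauchy-Schwarz, so e (r - p) = d (q - r); hence [r] divides the segment with weight d / (d +
    e). *)
Lemma edist_eq_on_segment p q r :
  edist p r + edist r q <= edist p q -> on_segment p q r.
Proof.
have hpr := sqr_edist p r; have hrq := sqr_edist r q.
have hpq := sqr_edist p q.
have d0 := edist_ge0 p r; have e0 := edist_ge0 r q.
have f0 := edist_ge0 p q.
set d := edist p r in d0 hpr *; set e := edist r q in e0 hrq *.
set f := edist p q in f0 hpq * => def.
have [de0|de0] := eqVneq (d + e) 0.
  have d00 : d = 0 by nra.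
  have h1 : (r.1 - p.1) ^+ 2 == 0.
    rewrite d00 in hpr; have := sqr_ge0 (r.2 - p.2).
    have := sqr_ge0 (r.1 - p.1); rewrite eq_le => *; apply/andP; nra.
  have h2 : (r.2 - p.2) ^+ 2 == 0.
    rewrite d00 in hpr; have := sqr_ge0 (r.2 - p.2).
    have := sqr_ge0 (r.1 - p.1); rewrite eq_le => *; apply/andP; nra.
  rewrite sqrf_eq0 subr_eq0 in h1; rewrite sqrf_eq0 subr_eq0 in h2.
  exists 0; split; rewrite ?lexx ?ler01//.
    by rewrite (eqP h1); ring.
  by rewrite (eqP h2); ring.
have de : 0 < d + e by rewrite lt_neqAle eq_sym de0 addr_ge0.
pose u1 := r.1 - p.1; pose u2 := r.2 - p.2.
pose v1 := q.1 - r.1; pose v2 := q.2 - r.2.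
have hd : d ^+ 2 = u1 ^+ 2 + u2 ^+ 2 by [].
have he : e ^+ 2 = v1 ^+ 2 + v2 ^+ 2 by [].
have hf : f ^+ 2 = (u1 + v1) ^+ 2 + (u2 + v2) ^+ 2.
  by rewrite hpq /u1 /u2 /v1 /v2; congr (_ ^+ 2 + _ ^+ 2); ring.
have uv : d * e <= u1 * v1 + u2 * v2.
  have : (d + e) ^+ 2 <= f ^+ 2 by rewrite ler_pXn2r ?nnegrE ?addr_ge0.
  by rewrite hf; nra.
(* The squared norm of e u - d v equals 2 d e (d e - u.v), which [uv] makes nonpositive. *)
have key : (e * u1 - d * v1) ^+ 2 + (e * u2 - d * v2) ^+ 2 <= 0.
  have -> : (e * u1 - d * v1) ^+ 2 + (e * u2 - d * v2) ^+ 2 =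
    e ^+ 2 * (u1 ^+ 2 + u2 ^+ 2) + d ^+ 2 * (v1 ^+ 2 + v2 ^+ 2)
    - 2 * (d * e) * (u1 * v1 + u2 * v2) by ring.
  rewrite -hd -he.
  have -> : e ^+ 2 * d ^+ 2 + d ^+ 2 * e ^+ 2 - 2 * (d * e) * (u1 * v1 + u2 * v2)
    = 2 * (d * e) * (d * e - (u1 * v1 + u2 * v2)) by ring.
  by rewrite mulr_ge0_le0 ?mulr_ge0// subr_le0.
have k1 : e * u1 = d * v1.
  apply/eqP; rewrite -subr_eq0 -sqrf_eq0 eq_le sqr_ge0 andbT.
  by apply: le_trans key; rewrite lerDl sqr_ge0.
have k2 : e * u2 = d * v2.
  apply/eqP; rewrite -subr_eq0 -sqrf_eq0 eq_le sqr_ge0 andbT.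
  by apply: le_trans key; rewrite lerDr sqr_ge0.
exists (d / (d + e)); split.
- by rewrite divr_ge0 ?(ltW de)//= ler_pdivrMr// mul1r lerDl.
- move: k1; rewrite /u1 /v1 => k1; apply: (mulfI de0).
  transitivity (e * p.1 + d * q.1); first by nra.
  by field.
- move: k2; rewrite /u2 /v2 => k2; apply: (mulfI de0).
  transitivity (e * p.2 + d * q.2); first by nra.
  by field.
Qed.

(** [t] is interior because the two-sided derivative at an endpoint also sees values outside the
    interval. Speeds of a curve and of its smooth piece are thus compared on open intervals, and the
    integrals ignore the endpoints. *)
Lemma derive1_congr (u v : R -> R) a b t : a < t < b ->
  (forall s, a <= s <= b -> u s = v s) -> derive1 u t = derive1 v t.
Proof.
move=> /andP[at_ tb] uv; rewrite !derive1E; apply: near_eq_derive.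
near=> s; apply: uv; apply/andP; split; near: s.
- exact: lt_le_nbhsr.
- exact: lt_le_nbhsl.
Unshelve. all: by end_near. Qed.

Lemma speed_congr g h a b t : a < t < b ->
  (forall s, a <= s <= b -> h s = g s) -> speed g t = speed h t.
Proof.
move=> tab hg; rewrite /speed; congr (Num.sqrt (_ ^+ 2 + _ ^+ 2));
  by apply: (derive1_congr tab) => s sab; rewrite hg.
Qed.

Lemma C2fun_continuous (u : R -> R) : C2fun u ->
  continuous u /\ continuous (derive1 u).
Proof.
case=> du ddu _; split=> t; apply: differentiable_continuous;
  exact/derivable1_diffP.
Qed.

Lemma speed_continuous h : C2curve h -> continuous (speed h).
Proof.
case=> /C2fun_continuous[_ c1] /C2fun_continuous[_ c2] t.
pose q t := derive1 (fun s => (h s).1) t ^+ 2 + derive1 (fun s => (h s).2) t ^+ 2.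
have cq : {for t, continuous q}.
  have cX (u : R -> R) : {for t, continuous u} ->
      {for t, continuous (fun t => u t ^+ 2)}.
    by move=> cu; exact: (continuous_comp cu (@exprn_continuous _ 2 (u t))).
  exact: (continuousD (cX _ (c1 t)) (cX _ (c2 t))).
exact: (continuous_comp cq (@sqrt_continuous R (q t))).
Qed.

(** Project [h] on the direction h b - h a: the projection [w] grows by D^2 according to the
    fundamental theorem, and its derivative is at most D times the speed by Cauchy-Schwarz. Dividing
    by D gives the bound. *)
Lemma length_C2curve h a b : C2curve h -> a < b ->
  mu.-integrable `[a, b] (EFin \o speed h) /\
  ((edist (h a) (h b))%:E <= \int[mu]_(t in `[a, b]) (speed h t)%:E)%E.
Proof.
move=> ch ab; have cs := speed_continuous ch.
have is_ : mu.-integrable `[a, b] (EFin \o speed h).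
  apply: continuous_compact_integrable; first exact: segment_compact.
  exact: continuous_subspaceT.
split=> //.
set D := edist _ _.
pose w t := ((h b).1 - (h a).1) * (h t).1 + ((h b).2 - (h a).2) * (h t).2.
pose w' t := ((h b).1 - (h a).1) * derive1 (fun s => (h s).1) t
  + ((h b).2 - (h a).2) * derive1 (fun s => (h s).2) t.
case: (ch) => -[d1 _ _] [d2 _ _].
have [/C2fun_continuous[c1 c1'] /C2fun_continuous[c2 c2']] := ch.
have dw t : is_derive t (1 : R) w (w' t).
  have h1 : is_derive t (1:R) (fun s => (h s).1) (derive1 (fun s => (h s).1) t).
    by apply: DeriveDef; rewrite ?derive1E.
  have h2 : is_derive t (1:R) (fun s => (h s).2) (derive1 (fun s => (h s).2) t).
    by apply: DeriveDef; rewrite ?derive1E.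
  exact: is_deriveD.
have cw : continuous w by move=> t; apply: differentiable_continuous;
  apply/derivable1_diffP; case: (dw t).
have cw' : continuous w'.
  by move=> t; apply: cvgD; apply: cvgMr; [exact: c1'|exact: c2'].
have cw's : {within `[a, b], continuous w'} by exact: continuous_subspaceT.
have ftc : (\int[mu]_(t in `[a, b]) (w' t)%:E = (w b)%:E - (w a)%:E)%E.
  apply: continuous_FTC2 => //.
    split.
    - by move=> t _; case: (dw t).
    - exact: cvg_at_right_filter (cw a).
    - exact: cvg_at_left_filter (cw b).
  by move=> t _; rewrite derive1E; have [_ ->] := dw t.
have wD : w b - w a = D ^+ 2 by rewrite sqr_edist /w; ring.
have iw' : mu.-integrable `[a, b] (EFin \o w').
  by apply: continuous_compact_integrable => //; exact: segment_compact.
have le1 : ((D ^+ 2)%:E <= D%:E * \int[mu]_(t in `[a, b]) (speed h t)%:E)%E.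
  rewrite -wD EFinB -ftc -integralZl//.
  apply: le_integral => //; first exact: integrableZl.
  move=> t _ /=; rewrite -EFinM lee_fin.
  by apply: cauchy_schwarz2; rewrite ?edist_ge0 ?speed_ge0 ?sqr_edist ?sqr_speed.
have [D0|D0] := eqVneq D 0.
  by rewrite D0; apply: integral_ge0 => t _; rewrite lee_fin speed_ge0.
have Dp : 0 < D by rewrite lt_neqAle eq_sym D0 edist_ge0.
by move: le1; rewrite expr2 EFinM lee_pmul2l// fin_numE.
Qed.

End Length.

(** * Piecewise smooth curves *)

Section PiecewiseC2.
Variable R : realType.
Implicit Types (g h : R -> R * R) (p q : R * R) (a b s t : R).
Let mu := @lebesgue_measure R.

(** Inductive form of [piecewise_C2], so that cutting, gluing and length estimates go by induction
    on the first piece. *)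
Inductive pieces g : R -> R -> Prop :=
| pieces_nil a : pieces g a a
| pieces_cons a c b h of a < c & C2curve h
    & (forall t, a <= t <= c -> h t = g t) & pieces g c b : pieces g a b.

Lemma piecesP g a b : piecewise_C2 g a b <-> pieces g a b.
Proof.
split=> [[s []]|].
  elim: s a => [|c s IH] a /=; first by move=> _ -> _; exact: pieces_nil.
  move=> /andP[ac sc] lb hs.
  have [h [h1 h2 hg]] := hs 0%N isT.
  apply: (pieces_cons ac (conj h1 h2) hg); apply: IH => // i si.
  have [k [k1 k2 kg]] := hs i.+1 si.
  have e1 : nth c (c :: s) i = nth a (c :: s) i.
    by apply: set_nth_default; exact: ltnW.
  by exists k; split=> // t; rewrite e1 (set_nth_default a c si); exact: kg.
elim=> {a b} [a|a c b h ac [h1 h2] hg _ [s [sc lb hs]]].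
  by exists [::]; split.
exists (c :: s); split=> //=; first by rewrite ac.
case=> [|i] si; first by exists h; split.
have [k [k1 k2 kg]] := hs i si.
have e1 : nth a (c :: s) i = nth c (c :: s) i.
  by apply: set_nth_default; exact: ltnW.
by exists k; split=> // t; rewrite [nth a (a :: _) _]e1 /= (set_nth_default c a si); exact: kg.
Qed.

Lemma pieces_le g a b : pieces g a b -> a <= b.
Proof. by elim=> // {}a c {}b h ac _ _ _; apply: le_trans; exact: ltW. Qed.

Lemma pieces_cat g a b c : pieces g a b -> pieces g b c -> pieces g a c.
Proof.
by elim=> // {}a d {}b h ad ch hg _ IH /IH; exact: pieces_cons ad ch hg.
Qed.

Lemma pieces_congr g g' a b : (forall t, a <= t <= b -> g t = g' t) ->
  pieces g a b -> pieces g' a b.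
Proof.
move=> gg' H; elim: H gg' => {a b} [a|a c b h ac ch hg cb IH] gg'.
  exact: pieces_nil.
have cb' := pieces_le cb.
apply: (pieces_cons ac ch) => [t /andP[at_ tc]|].
  by rewrite hg ?at_ ?tc// gg'// at_ (le_trans tc).
by apply: IH => t /andP[ct tb]; rewrite gg'// tb (le_trans (ltW ac)).
Qed.

Lemma pieces_C2 h a b : C2curve h -> a <= b -> pieces h a b.
Proof.
rewrite le_eqVlt => ch /predU1P[->|ab]; first exact: pieces_nil.
by apply: (pieces_cons ab ch) => //; exact: pieces_nil.
Qed.

Lemma pieces_split g a b t : pieces g a b -> a <= t <= b ->
  pieces g a t /\ pieces g t b.
Proof.
elim=> {a b} [a|a c b h ac ch hg cb IH] /andP[at_ tb].
  by rewrite (@le_anti _ _ t a) ?at_ ?tb//; split; exact: pieces_nil.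
have [tc|ct] := leP t c.
  split.
    apply: (pieces_congr _ (pieces_C2 ch at_)) => s /andP[as_ st].
    by rewrite hg// as_ (le_trans st).
  apply: pieces_cat cb; apply: (pieces_congr _ (pieces_C2 ch tc)) => s /andP[ts sc].
  by rewrite hg// sc (le_trans at_).
have [p1 p2] : pieces g c t /\ pieces g t b by apply: IH; rewrite (ltW ct).
by split=> //; exact: pieces_cons ac ch hg p1.
Qed.

Lemma pieces_sub g a b s t : pieces g a b -> a <= s -> s <= t -> t <= b ->
  pieces g s t.
Proof.
move=> gab as_ st tb.
have [_ gsb] := pieces_split gab (introT andP (conj as_ (le_trans st tb))).
by have [] := pieces_split gsb (introT andP (conj st tb)).
Qed.

Lemma curve_lengthD g a b c : measurable_fun `[a, c] (speed g) ->
  a <= b -> b <= c ->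
  (curve_length g a c = curve_length g a b + curve_length g b c)%E.
Proof.
move=> mg ab bc.
have E : `[a, c]%classic = `[a, b] `|` `]b, c].
  by rewrite -itv_bndbnd_setU// bnd_simp.
have mbc : measurable_fun `]b, c] (speed g).
  by apply: measurable_funS mg => //; apply: subset_itvr; rewrite bnd_simp.
rewrite /curve_length [in LHS]E ge0_integral_setU//=.
- by congr (_ + _)%E; apply: integral_itv_obnd_cbnd; exact/measurable_EFinP.
- by rewrite -E; exact/measurable_EFinP.
- rewrite disj_set2E; apply/eqP; rewrite -subset0 => t [] /=.
  by rewrite !in_itv/= => /andP[_ tb] /andP[bt _]; have := le_lt_trans tb bt; rewrite ltxx.
Qed.

(** Three claims in one induction, because additivity of length needs measurability on the whole
    interval. Finiteness later permits cancelling lengths in [\bar R]. *)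
Lemma pieces_length g a b : pieces g a b ->
  [/\ measurable_fun `[a, b] (speed g), (curve_length g a b < +oo)%E
    & ((edist (g a) (g b))%:E <= curve_length g a b)%E].
Proof.
elim=> {a b} [a|a c b h ac ch hg cb [mcb fcb lcb]].
  rewrite /curve_length set_itv1 integral_set1; split=> //.
    exact: measurable_fun_set1.
  by rewrite lee_fin /edist !subrr expr0n/= addr0 sqrtr0.
have cb' := pieces_le cb.
have [ih lh] := length_C2curve ch ac.
have sgh : {in `]a, c[, speed h =1 speed g}.
  move=> t; rewrite in_itv/= => tac; apply/esym.
  exact: (speed_congr tac hg).
have mh : measurable_fun `[a, c] (speed h).
  by have /integrableP[/measurable_EFinP] := ih.
have mh' : measurable_fun `]a, c[ (speed h).
  by apply: measurable_funS mh => //; exact: subset_itv_oo_cc.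
have mg' : measurable_fun `]a, c[ (speed g).
  by apply: eq_measurable_fun mh' => t; rewrite inE; exact: sgh.
have mg : measurable_fun `[a, c] (speed g) by exact: measurable_fun_itv_cc mg'.
have E : curve_length g a c = (\int[mu]_(t in `[a, c]) (speed h t)%:E)%E.
  by apply/esym; exact: eq_integral_itv_bounded.
have mab : measurable_fun `[a, b] (speed g).
  have -> : `[a, b]%classic = `[a, c] `|` `]c, b].
    by rewrite -itv_bndbnd_setU ?bnd_simp ?(ltW ac).
  apply/measurable_funU; [exact: measurable_itv|exact: measurable_itv|].
  split; first exact: mg.
  apply: measurable_funS mcb; first exact: measurable_itv.
  by apply: subset_itvr; rewrite bnd_simp.
have fac : (curve_length g a c < +oo)%E.
  by rewrite E; apply: (integrable_lty _ ih); exact: measurable_itv.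
have L := curve_lengthD mab (ltW ac) cb'.
split; [exact: mab|by rewrite L; exact: lte_add_pinfty|].
rewrite L; apply: (@le_trans _ _ ((edist (g a) (g c))%:E + (edist (g c) (g b))%:E)%E).
  by rewrite -EFinD lee_fin edist_triangle.
apply: leeD; last exact: lcb.
have <- : h a = g a by apply: hg; rewrite lexx ltW.
have <- : h c = g c by apply: hg; rewrite lexx ltW.
by rewrite E; exact: lh.
Qed.

End PiecewiseC2.

(** * Shortest curves are taut *)

Section ShortestCurve.
Variable R : realType.
Implicit Types (g h : R -> R * R) (p q : R * R) (a b s t : R).

(** Precomposition with [clamp] turns a curve controlled only on [a, b] into one continuous on the
    whole line and at rest outside [a, b], which frees later lemmas from side conditions on
    times. *)
Definition clamp a b t : R := Num.max a (Num.min b t).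

Lemma clamp_continuous a b : continuous (clamp a b).
Proof.
move=> t; apply: (@continuous_max _ _ (cst a) (fun t => Num.min b t)).
  exact: cvg_cst.
apply: (@continuous_min _ _ (cst b) id); first exact: cvg_cst.
exact: cvg_id.
Qed.

Lemma clamp_in a b t : a <= b -> a <= clamp a b t <= b.
Proof. by move=> ab; rewrite /clamp le_max lexx/= ge_max ab ge_min lexx. Qed.

Lemma clamp_id a b t : a <= t <= b -> clamp a b t = t.
Proof. by case/andP=> at_ tb; rewrite /clamp (min_idPr tb) (max_idPr at_). Qed.

Lemma clamp_le a b s t : s <= t -> clamp a b s <= clamp a b t.
Proof.
move=> st; rewrite /clamp ge_max le_max lexx/= le_max; apply/orP; right.
by rewrite le_min !ge_min lexx/= st orbT.
Qed.

Lemma clamp_left a b t : a <= b -> t <= a -> clamp a b t = a.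
Proof.
by move=> ab ta; rewrite /clamp (min_idPr (le_trans ta ab)) (max_idPl ta).
Qed.

Lemma clamp_right a b t : a <= b -> b <= t -> clamp a b t = b.
Proof. by move=> ab bt; rewrite /clamp (min_idPl bt) (max_idPr ab). Qed.

Lemma pieces_clamp_continuous g a b : pieces g a b ->
  continuous (fun t => (g (clamp a b t)).1) /\
  continuous (fun t => (g (clamp a b t)).2).
Proof.
elim=> {a b} [a|a c b h ac [/C2fun_continuous[h1 _] /C2fun_continuous[h2 _]] hg cb [IH1 IH2]].
  have E t : clamp a a t = a by apply: le_anti; rewrite andbC clamp_in.
  split.
    rewrite (_ : (fun t => _) = cst (g a).1); first by move=> t; exact: cvg_cst.
    by apply/funext => t; rewrite E.
  rewrite (_ : (fun t => _) = cst (g a).2); first by move=> t; exact: cvg_cst.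
  by apply/funext => t; rewrite E.
have bc := pieces_le cb.
(* gluing two pieces at [c] is addition, up to the constant [g c] *)
have E t : ((g (clamp a b t)).1 = (h (clamp a c t)).1 + (g (clamp c b t)).1 - (g c).1)
   * ((g (clamp a b t)).2 = (h (clamp a c t)).2 + (g (clamp c b t)).2 - (g c).2).
  have [tc|/ltW ct] := leP t c.
    have -> : clamp a b t = clamp a c t.
      by rewrite /clamp (min_idPr tc) (min_idPr (le_trans tc bc)).
    by rewrite hg ?clamp_in ?ltW// (clamp_left bc tc); split; ring.
  have -> : clamp a b t = clamp c b t.
    have cm : c <= Num.min b t by rewrite le_min bc.
    by rewrite /clamp (max_idPr cm) (max_idPr (le_trans (ltW ac) cm)).
  by rewrite (clamp_right (ltW ac) ct) hg ?lexx ?(ltW ac)//; split; ring.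
split=> t.
- rewrite (_ : (fun t => _) = (fun t => (h (clamp a c t)).1 + (g (clamp c b t)).1 - (g c).1)); last first.
    by apply/funext => s; rewrite E.
  apply: cvgB; last exact: cvg_cst.
  apply: cvgD; last exact: IH1.
  exact: (continuous_comp (@clamp_continuous a c t) (h1 (clamp a c t))).
- rewrite (_ : (fun t => _) = (fun t => (h (clamp a c t)).2 + (g (clamp c b t)).2 - (g c).2)); last first.
    by apply/funext => s; rewrite E.
  apply: cvgB; last exact: cvg_cst.
  apply: cvgD; last exact: IH2.
  exact: (continuous_comp (@clamp_continuous a c t) (h2 (clamp a c t))).
Qed.

Lemma curve_length_congr g g' a b : pieces g a b ->
  (forall t, a <= t <= b -> g t = g' t) ->
  curve_length g a b = curve_length g' a b.
Proof.
move=> gab gg'; have [mg _ _] := pieces_length gab.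
have [mg' _ _] := pieces_length (pieces_congr gg' gab).
apply: eq_integral_itv_bounded.
- by apply: measurable_funS mg; [exact: measurable_itv|exact: subset_itv_oo_cc].
- by apply: measurable_funS mg'; [exact: measurable_itv|exact: subset_itv_oo_cc].
- move=> t; rewrite in_itv/= => tab.
  by apply: (speed_congr tab) => s sab; rewrite gg'.
Qed.

Lemma derive1_affine (x y : R) : derive1 (fun t => x + y * t) = cst y.
Proof.
apply/funext => t; rewrite derive1E.
rewrite (_ : (fun t => _) = cst x + y *: (@id R)) //.
by rewrite deriveD// deriveZ// derive_cst derive_id add0r /GRing.scale/= mulr1.
Qed.

Lemma C2fun_affine (x y : R) : C2fun (fun t => x + y * t).
Proof.
split.
- move=> t; apply: derivableD; first exact: derivable_cst.
  by apply: derivableM; [exact: derivable_cst|exact: derivable_id].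
- by rewrite derive1_affine => t; exact: derivable_cst.
- rewrite derive1_affine (_ : derive1 _ = cst 0); first by move=> t; exact: cvg_cst.
  by apply/funext => t; rewrite derive1_cst.
Qed.

Definition chord s t p q (u : R) : R * R :=
  let l := (u - s) / (t - s) in
  ((1 - l) * p.1 + l * q.1, (1 - l) * p.2 + l * q.2).

Lemma chord_affine s t p q : s < t ->
  (forall u, (chord s t p q u).1 = (p.1 - s * ((q.1 - p.1) / (t - s)))
     + ((q.1 - p.1) / (t - s)) * u) /\
  (forall u, (chord s t p q u).2 = (p.2 - s * ((q.2 - p.2) / (t - s)))
     + ((q.2 - p.2) / (t - s)) * u).
Proof.
move=> st; have ts : t - s != 0 by rewrite subr_eq0 gt_eqF.
by split=> u /=; field.
Qed.

Lemma chord_C2 s t p q : s < t -> C2curve (chord s t p q).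
Proof.
move=> st; have [e1 e2] := chord_affine p q st.
split; [rewrite (funext e1)|rewrite (funext e2)]; exact: C2fun_affine.
Qed.

Lemma chord_length s t p q : s < t ->
  curve_length (chord s t p q) s t = (edist p q)%:E.
Proof.
move=> st; have [e1 e2] := chord_affine p q st.
rewrite /curve_length (funext e1) (funext e2) !derive1_affine.
under eq_integral do rewrite /=.
rewrite integral_cst; last by [].
rewrite [X in (_ * X)%E](_ : _ = (t - s)%:E); last first.
  by rewrite /= lebesgue_measure_itv/= lte_fin st EFinB.
have ts : 0 < t - s by rewrite subr_gt0.
rewrite -EFinM; congr EFin.
rewrite !exprMn -mulrDl sqrtrM ?addr_ge0 ?sqr_ge0// sqrtr_sqr.
by rewrite ger0_norm ?invr_ge0 ?(ltW ts)// mulfVK ?gt_eqF.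
Qed.

Lemma chord_on_segment s t p q u : s < t -> s <= u <= t ->
  on_segment p q (chord s t p q u).
Proof.
move=> st /andP[su ut]; exists ((u - s) / (t - s)); split=> //.
have ts : 0 < t - s by rewrite subr_gt0.
by rewrite divr_ge0 ?subr_ge0 ?(ltW st)//= ler_pdivrMr// mul1r lerB.
Qed.

Lemma on_segment_refl p q : on_segment p q p.
Proof. by exists 0; split; rewrite ?lexx ?ler01//; ring. Qed.

(** Minimality against the competitor [g'] bounds the arc by the chord, while the arc is at least as
    long as the broken line through [g r]; the equality case of the triangle inequality
    concludes. *)
Lemma shortest_on_segment (X : set (R * R)) (A B : R * R) g a b s r t :
  shortest_curve X A B g a b -> a <= s -> s <= r -> r <= t -> t <= b ->
  (forall q, on_segment (g s) (g t) q -> X q) ->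
  on_segment (g s) (g t) (g r).
Proof.
move=> [[ab /piecesP gab gX gA gB] gmin] as_ sr rt tb segX.
move: (le_trans sr rt); rewrite le_eqVlt => /predU1P[E|st].
  rewrite (@le_anti _ _ r s); first exact: on_segment_refl.
  by rewrite sr andbT E.
pose k := chord s t (g s) (g t).
have ts : t - s != 0 by rewrite subr_eq0 gt_eqF.
have ks : k s = g s.
  by rewrite /k /chord subrr mul0r; case: (g s) => ? ?; congr pair => /=; ring.
have kt : k t = g t.
  by rewrite /k /chord divff//; case: (g t) => ? ?; congr pair => /=; ring.
pose g' u := if (s <= u) && (u <= t) then k u else g u.
have ras : pieces g a s by apply: (pieces_sub gab) => //; exact: le_trans (ltW st) tb.
have rtb : pieces g t b by apply: (pieces_sub gab) => //; exact: le_trans as_ (ltW st).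
have e1 u : a <= u <= s -> g u = g' u.
  move=> /andP[_ us]; rewrite /g'; case: ifP => // /andP[su _].
  by rewrite (@le_anti _ _ u s) ?ks// us su.
have e2 u : t <= u <= b -> g u = g' u.
  move=> /andP[tu _]; rewrite /g'; case: ifP => // /andP[_ ut].
  by rewrite (@le_anti _ _ u t) ?kt// ut tu.
have e3 u : s <= u <= t -> k u = g' u by move=> H; rewrite /g' H.
have kst : pieces k s t by apply: pieces_C2 (ltW st); exact: chord_C2.
have p1 := pieces_congr e1 ras; have p2 := pieces_congr e2 rtb.
have p3 := pieces_congr e3 kst.
have g'at := pieces_cat p1 p3.
have g'ab := pieces_cat g'at p2.
have g'in : curve_in X A B g' a b.
  split=> //.
  - exact/piecesP.
  - move=> u /andP[au ub]; rewrite /g'; case: ifP => [sut|_].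
      by apply: segX; exact: chord_on_segment.
    by apply: gX; rewrite au.
  - by rewrite -e1 ?lexx.
  - by rewrite -e2 ?lexx ?tb.
have gmin' := gmin _ _ _ g'in.
have [mg' _ _] := pieces_length g'ab; have [mg _ _] := pieces_length gab.
have [mat' _ _] := pieces_length g'at.
have sb := le_trans (ltW st) tb; have at_ := le_trans as_ (ltW st).
have gsb : pieces g s b by apply: (pieces_sub gab).
have gst : pieces g s t by apply: (pieces_sub gab) => //; exact: ltW.
have gsr : pieces g s r by apply: (pieces_sub gst).
have grt : pieces g r t by apply: (pieces_sub gst).
have [msb _ _] := pieces_length gsb; have [mst _ _] := pieces_length gst.
have L' : curve_length g' a b = (curve_length g a s + (edist (g s) (g t))%:E
    + curve_length g t b)%E.
  rewrite (curve_lengthD mg' at_ tb) (curve_lengthD mat' as_ (ltW st)).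
  rewrite -(curve_length_congr ras e1) -(curve_length_congr rtb e2).
  by rewrite -(curve_length_congr kst e3) chord_length.
have L : curve_length g a b = (curve_length g a s +
    ((curve_length g s r + curve_length g r t) + curve_length g t b))%E.
  by rewrite (curve_lengthD mg as_ sb) (curve_lengthD msb (ltW st) tb)
    (curve_lengthD mst sr rt).
(* All lengths are real numbers, so the common outer arcs can be cancelled. *)
have fin u v : pieces g u v -> exists2 l, curve_length g u v = l%:E
    & edist (g u) (g v) <= l.
  move=> /pieces_length[_]; case: (curve_length g u v) => [l| |]// _.
  by rewrite lee_fin => ul; exists l.
have [l1 E1 _] := fin _ _ ras; have [l2 E2 d2] := fin _ _ gsr.
have [l3 E3 d3] := fin _ _ grt; have [l4 E4 _] := fin _ _ rtb.
apply: edist_eq_on_segment; apply: le_trans (lerD d2 d3) _.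
by move: gmin'; rewrite L L' E1 E2 E3 E4 -!EFinD lee_fin; lra.
Qed.

End ShortestCurve.

(** * Contact of a taut curve with the boundary *)

Section RealAux.
Variable R : realType.
Implicit Types (u : R -> R) (P : R -> Prop) (f : {poly R}).

Lemma exists_left P (s t : R) : s < t -> (\forall r \near t, P r) ->
  exists2 r, s <= r < t & P r.
Proof.
move=> st Pt; have : \forall r \near t^'-, s <= r < t /\ P r.
  near=> r; split; last by near: r; exact: cvg_within Pt.
  by apply/andP; split; near: r; [exact: nbhs_left_ge|exact: nbhs_left_lt].
by case/filter_ex => r []; exists r.
Unshelve. all: by end_near. Qed.

Lemma exists_right P (s t : R) : s < t -> (\forall r \near s, P r) ->
  exists2 r, s < r <= t & P r.
Proof.
move=> st Ps; have : \forall r \near s^'+, s < r <= t /\ P r.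
  near=> r; split; last by near: r; exact: cvg_within Ps.
  by apply/andP; split; near: r; [exact: nbhs_right_gt|exact: nbhs_right_le].
by case/filter_ex => r []; exists r.
Unshelve. all: by end_near. Qed.

Let zeros u (s r : R) := `[s, r]%classic `&` u @^-1` [set 0].

Let zeros_compact u s r : continuous u -> compact (zeros u s r).
Proof.
move=> cu; apply: compact_closedI; first exact: segment_compact.
by apply: preimage_closed => [t _|]; [exact: cu|exact: closed_eq].
Qed.

(** The zero set in [s, r] is compact, so [id] attains its minimum on it. This is how arrival at a
    position, or at the boundary, is located in time. *)
Lemma first_zero u (s r : R) : continuous u -> s <= r -> u s != 0 -> u r = 0 ->
  exists z, [/\ s < z <= r, u z = 0 & forall w, s <= w < z -> u w != 0].
Proof.
move=> cu sr us ur.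
have [||z] := @compact_EVT_min R R id (zeros u s r) _ (zeros_compact (s := s) (r := r) cu) _.
- by exists r; split=> //=; rewrite in_itv/= sr lexx.
- by apply: continuous_subspaceT => ?; exact: cvg_id.
rewrite inE => -[]/=; rewrite in_itv/= => /andP[sz zr] uz zmin.
exists z; split=> //.
  rewrite zr andbT lt_neqAle sz andbT; apply: contra us => /eqP->.
  by rewrite uz.
move=> w /andP[sw wz]; apply/eqP => uw.
have : z <= w.
  apply: zmin; rewrite inE; split=> //=; rewrite in_itv/= sw.
  exact: le_trans (ltW wz) zr.
by rewrite leNgt wz.
Qed.

Lemma last_zero u (s r : R) : continuous u -> s <= r -> u s = 0 -> u r != 0 ->
  exists z, [/\ s <= z < r, u z = 0 & forall w, z < w <= r -> u w != 0].
Proof.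
move=> cu sr us ur.
have [||z] := @compact_EVT_max R R id (zeros u s r) _ (zeros_compact (s := s) (r := r) cu) _.
- by exists s; split=> //=; rewrite in_itv/= sr lexx.
- by apply: continuous_subspaceT => ?; exact: cvg_id.
rewrite inE => -[]/=; rewrite in_itv/= => /andP[sz zr] uz zmax.
exists z; split=> //.
  rewrite sz/= lt_neqAle zr andbT; apply: contra ur => /eqP<-.
  by rewrite uz.
move=> w /andP[zw wr]; apply/eqP => uw.
have : w <= z.
  apply: zmax; rewrite inE; split=> //=; rewrite in_itv/= wr andbT.
  exact: le_trans sz (ltW zw).
by rewrite leNgt zw.
Qed.

(** The difference is l (1 - l) (v - u) times the increment of f' between mean value points on the
    two sides of the division point; a third mean value turns that increment into f''. *)
Lemma chord_gap f (u v l : R) : u < v -> 0 < l < 1 ->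
  exists xi k, [/\ u < xi < v, 0 < k &
    (1 - l) * f.[u] + l * f.[v] - f.[(1 - l) * u + l * v] = f^`()^`().[xi] * k].
Proof.
move=> uv /andP[l0 l1]; set w := (1 - l) * u + l * v.
have uw : u < w by rewrite /w; nra.
have wv : w < v by rewrite /w; nra.
have [x1 + e1] := poly_mvt f uw; rewrite in_itv/= => /andP[ux1 x1w].
have [x2 + e2] := poly_mvt f wv; rewrite in_itv/= => /andP[wx2 x2v].
have x12 : x1 < x2 by apply: lt_trans wx2.
have [x3 + e3] := poly_mvt f^`() x12; rewrite in_itv/= => /andP[x13 x32].
exists x3, ((x2 - x1) * ((1 - l) * l * (v - u))); split.
- by rewrite (lt_trans ux1 x13) (lt_trans x32 x2v).
- by rewrite !mulr_gt0 ?subr_gt0.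
rewrite mulrA -e3.
have -> : (1 - l) * f.[u] + l * f.[v] - f.[w] =
  l * (f.[v] - f.[w]) - (1 - l) * (f.[w] - f.[u]) by ring.
by rewrite e1 e2 /w; ring.
Qed.

(** The sign comes from [chord_gap]. [u] and [v] are unordered, since a curve may run leftwards and
    its chords follow the order of time. *)
Lemma convex_below_chord f (I : set R) (u v l : R) : is_interval I -> I u -> I v ->
  (forall z, I z -> 0 <= f^`()^`().[z]) -> 0 <= l <= 1 ->
  f.[(1 - l) * u + l * v] <= (1 - l) * f.[u] + l * f.[v].
Proof.
move=> II; wlog uv : u v l / u <= v => [wl|] Iu Iv f2 /andP[l0 l1].
  have [uv|/ltW vu] := leP u v; first by apply: wl => //; rewrite l0.
  have -> : (1 - l) * u + l * v = (1 - (1 - l)) * v + (1 - l) * u by ring.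
  have -> : (1 - l) * f.[u] + l * f.[v] = (1 - (1 - l)) * f.[v] + (1 - l) * f.[u].
    by ring.
  by apply: wl => //; rewrite subr_ge0 l1 lerBlDr lerDl.
move: uv; rewrite le_eqVlt => /predU1P[->|uv].
  by rewrite -!mulrDl subrK !mul1r.
move: l0; rewrite le_eqVlt => /predU1P[<-|l0]; first by rewrite subr0 !mul1r !mul0r !addr0.
move: l1; rewrite le_eqVlt => /predU1P[->|l1]; first by rewrite subrr !mul1r !mul0r !add0r.
have [|xi [k [/andP[uxi xiv] k0 E]]] := chord_gap f uv (l := l); first by rewrite l0.
rewrite -subr_ge0 E mulr_ge0 ?(ltW k0)// f2//.
by apply: (II u v) => //; rewrite !ltW.
Qed.

Lemma concave_above_chord f (I : set R) (u v l : R) : is_interval I -> I u -> I v ->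
  (forall z, I z -> f^`()^`().[z] < 0) -> 0 < l < 1 -> u != v ->
  (1 - l) * f.[u] + l * f.[v] < f.[(1 - l) * u + l * v].
Proof.
move=> II; wlog uv : u v l / u <= v => [wl|] Iu Iv f2 /andP[l0 l1] nuv.
  have [uv|/ltW vu] := leP u v; first by apply: wl => //; rewrite l0.
  have -> : (1 - l) * u + l * v = (1 - (1 - l)) * v + (1 - l) * u by ring.
  have -> : (1 - l) * f.[u] + l * f.[v] = (1 - (1 - l)) * f.[v] + (1 - l) * f.[u].
    by ring.
  by apply: wl => //; [rewrite subr_gt0 l1 ltrBlDr ltrDl|rewrite eq_sym].
have {}uv : u < v by rewrite lt_neqAle nuv.
have [|xi [k [/andP[uxi xiv] k0 E]]] := chord_gap f uv (l := l); first by rewrite l0.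
rewrite -subr_lt0 E pmulr_llt0// f2//.
by apply: (II u v) => //; rewrite !ltW.
Qed.

(** The two disjunctions are the form in which [taut_x_le] and [taut_x_ge] confine the abscissa,
    whatever the direction of travel. *)
Lemma between_combination (u v w : R) : w <= u \/ w <= v -> u <= w \/ v <= w ->
  exists2 l, 0 <= l <= 1 & w = (1 - l) * u + l * v.
Proof.
move=> h1 h2; have [uv|uv] := eqVneq u v.
  by exists 0; rewrite ?lexx ?ler01// uv; case: h1 h2 => ? [] ?; lra.
have nvu : v - u != 0 by rewrite subr_eq0 eq_sym.
exists ((w - u) / (v - u)); last by field.
have [/ltW uv'|vu|E] := ltgtP u v; last by rewrite E eqxx in uv.
  have p : 0 < v - u by rewrite subr_gt0 lt_neqAle uv.
  by rewrite ler_pdivlMr// ler_pdivrMr// mul0r mul1r; apply/andP; case: h1 h2 => ? [] ?; split; lra.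
have p : v - u < 0 by rewrite subr_lt0.
by rewrite ler_ndivlMr// ler_ndivrMr// mul0r mul1r; apply/andP; case: h1 h2 => ? [] ?; split; lra.
Qed.

Lemma combination_ball (c d u v l : R) : 0 <= l <= 1 ->
  `|u - c| < d -> `|v - c| < d -> `|(1 - l) * u + l * v - c| < d.
Proof.
move=> /andP[l0 l1] hu hv; pose M := Num.max `|u - c| `|v - c|.
have uM : `|u - c| <= M by rewrite le_max lexx.
have vM : `|v - c| <= M by rewrite le_max lexx orbT.
have Md : M < d by rewrite gt_max hu.
apply: le_lt_trans Md.
have -> : (1 - l) * u + l * v - c = (1 - l) * (u - c) + l * (v - c) by ring.
have l1' : 0 <= 1 - l by rewrite subr_ge0.
apply: le_trans (ler_normD _ _) _.
rewrite !normrM (ger0_norm l0) (ger0_norm l1').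
have -> : M = (1 - l) * M + l * M by ring.
by apply: lerD; rewrite ler_wpM2l.
Qed.

End RealAux.

(** * Taut curves below a polynomial graph *)

Section TautCurve.
Variables (R : realType) (f : {poly R}) (x y : R -> R).
Hypotheses (cx : continuous x) (cy : continuous y).
Hypothesis below : forall t, y t <= f.[x t].

Definition combination (s t r : R) := exists l : R,
  [/\ 0 <= l <= 1, x r = (1 - l) * x s + l * x t
    & y r = (1 - l) * y s + l * y t].

(** The sole trace of minimality in this section; neither length nor smoothness of the curve appears
    in it. *)
Hypothesis taut : forall s r t, s <= r -> r <= t ->
  (forall l, 0 <= l <= 1 ->
     (1 - l) * y s + l * y t <= f.[(1 - l) * x s + l * x t]) ->
  combination s t r.

Lemma taut_vertical s r t : s <= r -> r <= t -> x s = x t -> combination s t r.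
Proof.
move=> sr rt xst; apply: taut => // l /andP[l0 l1].
rewrite -xst -mulrDl subrK mul1r.
have := below s; have := below t; rewrite -xst; nra.
Qed.

Lemma taut_const s r t : s <= r -> r <= t -> x s = x t -> y s = y t ->
  x r = x s /\ y r = y s.
Proof.
move=> sr rt xst yst; have [l [_ -> ->]] := taut_vertical sr rt xst.
by rewrite -xst -yst; split; ring.
Qed.

(** Were [x r] larger than both, the intermediate value theorem would give times on either side of
    [r] with a common abscissa c < x r, and the vertical chord between them would force x r = c. *)
Lemma taut_x_le s r t : s <= r -> r <= t -> x r <= x s \/ x r <= x t.
Proof.
move=> sr rt; apply: contrapT => /not_orP[/negP + /negP].
rewrite -!ltNge => xsr xtr.
pose m := Num.max (x s) (x t); pose c := (m + x r) / 2.
have mr : m < x r by rewrite gt_max xsr.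
have [sm tm] : x s <= m /\ x t <= m by rewrite !le_max !lexx orbT.
have cx' A : {within A, continuous x} by exact: continuous_subspaceT.
have [s' + xs'] : exists2 s', s' \in `[s, r] & x s' = c.
  by apply: IVT => //; rewrite ge_min le_max /c; apply/andP; split; apply/orP; [left|right]; lra.
have [t' + xt'] : exists2 t', t' \in `[r, t] & x t' = c.
  by apply: IVT => //; rewrite ge_min le_max /c; apply/andP; split; apply/orP; [right|left]; lra.
rewrite !in_itv/= => /andP[rt' _] /andP[_ s'r].
have [l [_ + _]] := taut_vertical s'r rt' (etrans xs' (esym xt')).
by rewrite xs' xt' /c; lra.
Qed.

Lemma taut_x_ge s r t : s <= r -> r <= t -> x s <= x r \/ x t <= x r.
Proof.
move=> sr rt; apply: contrapT => /not_orP[/negP + /negP].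
rewrite -!ltNge => xsr xtr.
pose m := Num.min (x s) (x t); pose c := (m + x r) / 2.
have mr : x r < m by rewrite lt_min xsr.
have [sm tm] : m <= x s /\ m <= x t by rewrite !ge_min !lexx orbT.
have cx' A : {within A, continuous x} by exact: continuous_subspaceT.
have [s' + xs'] : exists2 s', s' \in `[s, r] & x s' = c.
  by apply: IVT => //; rewrite ge_min le_max /c; apply/andP; split; apply/orP; [right|left]; lra.
have [t' + xt'] : exists2 t', t' \in `[r, t] & x t' = c.
  by apply: IVT => //; rewrite ge_min le_max /c; apply/andP; split; apply/orP; [left|right]; lra.
rewrite !in_itv/= => /andP[rt' _] /andP[_ s'r].
have [l [_ + _]] := taut_vertical s'r rt' (etrans xs' (esym xt')).
by rewrite xs' xt' /c; lra.
Qed.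

Lemma taut_x_between s r t : s <= r -> r <= t ->
  exists2 l, 0 <= l <= 1 & x r = (1 - l) * x s + l * x t.
Proof.
move=> sr rt; apply: between_combination;
  [exact: taut_x_le|exact: taut_x_ge].
Qed.

Lemma taut_interval (I : set R) s r t : is_interval I -> s <= r -> r <= t ->
  I (x s) -> I (x t) -> I (x r).
Proof.
move=> II sr rt Is It.
have h1 := taut_x_le sr rt; have h2 := taut_x_ge sr rt.
have [xst|xts] := leP (x s) (x t).
  by apply: (II (x s) (x t)) => //; apply/andP; case: h1 h2 => ? [] ?; split; lra.
by apply: (II (x t) (x s)) => //; apply/andP; case: h1 h2 => ? [] ?; split; lra.
Qed.

(** One continuous function whose zeros are the times spent at the position of time [t0], so that
    [first_zero] and [last_zero] apply to positions. *)
Let sqdist t0 t := (x t - x t0) ^+ 2 + (y t - y t0) ^+ 2.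

Let sqdist_continuous t0 : continuous (sqdist t0).
Proof.
move=> t; have cX (u : R -> R) : {for t, continuous u} ->
    {for t, continuous (fun t => u t ^+ 2)}.
  by move=> cu; exact: (continuous_comp cu (@exprn_continuous _ 2 (u t))).
apply: (continuousD (cX _ _) (cX _ _)).
- by apply: cvgB; [exact: cx|exact: cvg_cst].
- by apply: cvgB; [exact: cy|exact: cvg_cst].
Qed.

Let sqdist0 t0 t : sqdist t0 t = 0 <-> x t = x t0 /\ y t = y t0.
Proof.
split=> [/eqP|[e1 e2]]; last by rewrite /sqdist e1 e2 !subrr expr0n addr0.
rewrite paddr_eq0 ?sqr_ge0// !sqrf_eq0 !subr_eq0.
by move=> /andP[/eqP -> /eqP ->].
Qed.

(* A contact point over a strictly concave arc is an extreme point of the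
   locally convex set below the arc, so a taut curve cannot pass through it. *)
Lemma taut_concave_contact (I : set R) s t0 t : open I -> is_interval I ->
  (forall z, I z -> f^`()^`().[z] < 0) ->
  s <= t0 -> t0 <= t -> I (x t0) -> y t0 = f.[x t0] ->
  (x s = x t0 /\ y s = y t0) \/ (x t = x t0 /\ y t = y t0).
Proof.
move=> oI II f2 st0 t0t It0 ct0.
apply: contrapT => /not_orP[ns nt].
have /eqP ns' : sqdist t0 s <> 0 by rewrite sqdist0.
have /eqP nt' : sqdist t0 t <> 0 by rewrite sqdist0.
have z0 : sqdist t0 t0 = 0 by exact/sqdist0.
(* Arrival at the contact position and departure from it; just outside these times lie [r1] and
   [r2], off that position but still over [I]. *)
have [t1 [/andP[st1 t1t0] /sqdist0[x1 y1] n1]] :=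
  first_zero (@sqdist_continuous t0) st0 ns' z0.
have [t2 [/andP[t0t2 t2t] /sqdist0[x2 y2] n2]] :=
  last_zero (@sqdist_continuous t0) t0t z0 nt'.
have nI r : x r = x t0 -> \forall r' \near r, I (x r').
  by move=> xr; apply: cx; apply: open_nbhs_nbhs; split=> //; rewrite xr.
have [r1 /andP[sr1 r1t1] I1] := exists_left st1 (nI _ x1).
have [r2 /andP[t2r2 r2t] I2] := exists_right t2t (nI _ x2).
have nr1 : ~ (x r1 = x t0 /\ y r1 = y t0).
  by move/sqdist0/eqP; apply/negP; apply: n1; rewrite sr1.
have nr2 : ~ (x r2 = x t0 /\ y r2 = y t0).
  by move/sqdist0/eqP; apply/negP; apply: n2; rewrite t2r2.
have b1 := below r1; have b2 := below r2.
have r1t0 : r1 <= t0 by rewrite ltW// (lt_le_trans r1t1).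
have t0r2 : t0 <= r2 by rewrite ltW// (le_lt_trans t0t2).
(* On a common vertical, the contact point would be a convex combination of two strictly lower
   points. *)
have [E|nE] := eqVneq (x r1) (x r2).
  have [l [/andP[l0 l1] ex ey]] := taut_vertical r1t0 t0r2 E.
  have e1 : x r1 = x t0 by rewrite ex -E; ring.
  rewrite -E e1 -ct0 in b2; rewrite e1 -ct0 in b1.
  have [h|h] := eqVneq (y r1) (y t0); first by apply: nr1.
  have [h'|h'] := eqVneq (y r2) (y t0); first by apply: nr2; rewrite -E.
  have {}b1 : y r1 < y t0 by rewrite lt_neqAle h.
  have {}b2 : y r2 < y t0 by rewrite lt_neqAle h'.
  have p1 : 0 <= (1 - l) * (y t0 - y r1) by rewrite mulr_ge0 ?subr_ge0 // ltW.
  have p2 : 0 <= l * (y t0 - y r2) by rewrite mulr_ge0 ?subr_ge0 // ltW.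
  have [hl|hl] := leP l 0.
    by have l00 : l = 0 by [lra]; rewrite l00 in ey; lra.
  have : 0 < l * (y t0 - y r2) by rewrite mulr_gt0 ?subr_gt0.
  by lra.
(* Otherwise the open chord is strictly below the graph and cannot carry the contact point. *)
have strict l : 0 < l < 1 ->
    (1 - l) * y r1 + l * y r2 < f.[(1 - l) * x r1 + l * x r2].
  move=> l01; apply: le_lt_trans (concave_above_chord II I1 I2 f2 l01 nE).
  by case/andP: l01 => ? ?; rewrite lerD// ler_wpM2l// ?subr_ge0 ltW.
have [|l [/andP[l0 l1] ex ey]] := taut r1t0 t0r2.
  move=> l /andP[]; rewrite le_eqVlt => /predU1P[<- _|l0].
    by rewrite subr0 !mul1r !mul0r !addr0.
  rewrite le_eqVlt => /predU1P[->|l1]; first by rewrite subrr !mul1r !mul0r !add0r.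
  by apply/ltW/strict; rewrite l0.
move: l0; rewrite le_eqVlt => /predU1P[l0|l0].
  by apply: nr1; rewrite ex ey -l0; split; ring.
move: l1; rewrite le_eqVlt => /predU1P[l1|l1].
  by apply: nr2; rewrite ex ey l1; split; ring.
have := strict l; rewrite l0 l1 => /(_ isT).
by rewrite -ex -ey ct0 ltxx.
Qed.

Let slack t := f.[x t] - y t.

Let slack_continuous : continuous slack.
Proof.
move=> t; apply: cvgB; last exact: cy.
exact: (continuous_comp (@cx t) (@continuous_horner R f (x t))).
Qed.

Let nonzero_slack t : slack t != 0 -> y t < f.[x t].
Proof. by rewrite subr_eq0 => h; rewrite lt_neqAle eq_sym h below. Qed.

Let local_box t : y t < f.[x t] -> exists2 d, 0 < d &
  forall x' y', `|x' - x t| < d -> `|y' - y t| < d -> y' <= f.[x'].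
Proof.
(* Half of the slack absorbs the change of [f], the other half the change of the ordinate. *)
move=> h; pose e := (f.[x t] - y t) / 2.
have e0 : 0 < e by rewrite divr_gt0 ?subr_gt0.
have /cvgrPdist_lt/(_ e e0)/nbhs_ballP[d /= d0 hd] := @continuous_horner R f (x t).
exists (Num.min d e); first by rewrite lt_min d0.
move=> x' y'; rewrite !lt_min => /andP[h1 _] /andP[_ h2].
have := hd x'; rewrite /ball/= distrC => /(_ h1).
rewrite ltr_distl => /andP[_ h3]; move: h2; rewrite ltr_distl => /andP[_ h4].
by rewrite /e in h3 h4; lra.
Qed.

(* Otherwise consider a maximal time interval without contact.  There the
   curve lies strictly below the chord of its endpoints; at the last lowest
   point in the direction normal to that chord the curve is locally free, hence
   locally straight, which is impossible. *)
Lemma taut_convex_contact (I : set R) s r t : is_interval I ->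
  (forall z, I z -> 0 <= f^`()^`().[z]) -> s <= r -> r <= t ->
  I (x s) -> I (x t) -> y s = f.[x s] -> y t = f.[x t] -> y r = f.[x r].
Proof.
move=> II f2 sr rt Is It cs ct; apply: contrapT => nr.
have sr0 : slack r != 0 by rewrite subr_eq0 eq_sym; exact/eqP.
have ss0 : slack s = 0 by rewrite /slack cs subrr.
have st0 : slack t = 0 by rewrite /slack ct subrr.
(* [p] and [q] are the last contact before [r] and the first one after it. *)
have [p [/andP[sp pr] p0 np]] := last_zero (@slack_continuous) sr ss0 sr0.
have [q [/andP[rq qt] q0 nq]] := first_zero (@slack_continuous) rt sr0 st0.
have cp : y p = f.[x p] by apply/esym/eqP; rewrite -subr_eq0; apply/eqP.
have cq : y q = f.[x q] by apply/esym/eqP; rewrite -subr_eq0; apply/eqP.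
have pq := lt_trans pr rq.
have free u : p < u < q -> y u < f.[x u].
  move=> /andP[pu uq]; apply: nonzero_slack; have [ur|ru] := leP u r.
    by apply: np; rewrite pu.
  by apply: nq; rewrite uq ltW.
have Ip : I (x p).
  exact: taut_interval II sp (le_trans (ltW pr) rt) Is It.
have Iq : I (x q).
  exact: taut_interval II (le_trans sr (ltW rq)) qt Is It.
have [E|nE] := eqVneq (x p) (x q).
  have [] := taut_const (ltW pr) (ltW rq) E; first by rewrite cp cq E.
  by move=> xr yr; apply: nr; rewrite xr yr.
have nqp : x q - x p != 0 by rewrite subr_eq0 eq_sym.
(* [v] is the height relative to the direction of the chord from [p] to [q]: equal at both ends, and
   strictly smaller in between by convexity. *)
pose m := (y q - y p) / (x q - x p).
pose v u := y u - m * x u.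
have cv : continuous v.
  move=> u; apply: cvgB; first exact: cy.
  by apply: cvgMr; exact: cx.
have vpq : v q = v p by rewrite /v /m; field.
have vlt u : p < u < q -> v u < v p.
  move=> puq; have := free u puq; case/andP: puq => pu uq.
  have [l l01 xu] := taut_x_between (ltW pu) (ltW uq).
  have := convex_below_chord II Ip Iq f2 l01; rewrite -xu -cp -cq => h1 h2.
  have : v u < (1 - l) * v p + l * v q.
    rewrite /v xu.
    have -> : (1 - l) * (y p - m * x p) + l * (y q - m * x q) =
      ((1 - l) * y p + l * y q) - m * ((1 - l) * x p + l * x q) by ring.
    by rewrite ltrD2r (lt_le_trans h2).
  by rewrite vpq -mulrDl subrK mul1r.
have cv' A : {within A, continuous v} by exact: continuous_subspaceT.
have [c + cmin] := EVT_min (ltW pq) (cv' _).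
rewrite in_itv/= => /andP[pc cq'].
have vc : v c < v p.
  apply: (@le_lt_trans _ _ (v r)); last by apply: vlt; rewrite pr.
  by apply: cmin; rewrite in_itv/= !ltW.
have chi_c : continuous (fun u => v u - v c).
  by move=> u; apply: cvgB; [exact: cv|exact: cvg_cst].
have qc : v q - v c != 0 by rewrite subr_eq0 vpq gt_eqF.
(* [t2] is the last time at the minimal level, so [v] is strictly larger afterwards; [t1] below is
   the first time at the position of [t2]. *)
have [t2 [/andP[ct2 t2q] + nt2]] := last_zero chi_c cq' (subrr _) qc.
move/eqP; rewrite subr_eq0 => /eqP vt2.
have pt2 : p < t2.
  rewrite lt_neqAle (le_trans pc ct2) andbT; apply/eqP => E.
  by rewrite E vt2 ltxx in vc.
have np2 : sqdist t2 p != 0.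
  apply/eqP => /sqdist0[e1 e2]; move: vc.
  by rewrite -vt2 /v e1 e2 ltxx.
have z2 : sqdist t2 t2 = 0 by exact/sqdist0.
have [t1 [/andP[pt1 t1t2] /sqdist0[x1 y1] nt1]] :=
  first_zero (@sqdist_continuous t2) (ltW pt2) np2 z2.
have [|d d0 box] := @local_box t2; first by apply: free; rewrite pt2.
have near_box u : x u = x t2 -> y u = y t2 ->
    \forall u' \near u, `|x u' - x t2| < d /\ `|y u' - y t2| < d.
  move=> <- <-; near=> u'; rewrite distrC [in X in _ /\ X]distrC; split; near: u'.
    by have /cvgrPdist_lt := @cx u; exact.
  by have /cvgrPdist_lt := @cy u; exact.
have [r1 /andP[pr1 r1t1] [dx1 dy1]] := exists_left pt1 (near_box _ x1 y1).
have [r2 /andP[t2r2 r2q] [dx2 dy2]] := exists_right t2q (near_box _ erefl erefl).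
have r1t2 : r1 <= t2 by rewrite ltW// (lt_le_trans r1t1).
have [|l [/andP[l0 l1] ex ey]] := taut r1t2 (ltW t2r2).
  move=> l /andP[l0 l1]; apply: box.
    by apply: combination_ball dx1 dx2; rewrite l0.
  by apply: combination_ball dy1 dy2; rewrite l0.
have v1 : v c <= v r1.
  apply: cmin; rewrite in_itv/= pr1 (le_trans r1t2)//; exact: ltW.
have v2 : v c < v r2.
  have := nt2 r2; rewrite t2r2 r2q subr_eq0 => /(_ isT) h.
  rewrite lt_neqAle eq_sym h cmin// in_itv/= r2q andbT.
  by rewrite ltW// (lt_trans pt2).
(* The minimum is a convex combination of v r1 >= v c and v r2 > v c, so the weight of [r2] vanishes
   and [r1] already sits at the position of [t2], before its first visit [t1]. *)
have vv : v c = (1 - l) * v r1 + l * v r2.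
  by rewrite -vt2 /v ex ey; ring.
have l00 : l = 0.
  have p1 : 0 <= (1 - l) * (v r1 - v c) by rewrite mulr_ge0 ?subr_ge0.
  apply: le_anti; rewrite l0 andbT -(pmulr_lle0 _ (_ : 0 < v r2 - v c)) ?subr_gt0//.
  by lra.
have := nt1 r1; rewrite pr1 r1t1 => /(_ isT)/eqP; apply; apply/sqdist0.
by rewrite ex ey l00; split; ring.
Unshelve. all: by end_near. Qed.

End TautCurve.

(** * Counting interactions *)

Section Components.
Variable R : realType.
Implicit Types S : set R.

Lemma component_eq_of_segment S (p q : R) : p <= q ->
  (forall s, p <= s <= q -> S s) ->
  connected_component S p = connected_component S q.
Proof.
move=> pq pqS; apply: same_connected_component.
apply: (@connected_component_max _ S `[p, q]%classic p).
- by rewrite /= in_itv/= lexx.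
- by move=> s /=; rewrite in_itv/=; exact: pqS.
- by apply/connected_intervalP; exact: interval_is_interval.
- by rewrite /= in_itv/= pq lexx.
Qed.

Lemma component_gap S (p q : R) : p < q -> S p -> S q ->
  connected_component S p <> connected_component S q ->
  exists2 s, p < s < q & ~ S s.
Proof.
move=> pq Sp Sq ne; apply: contrapT => nex; apply: ne.
apply: component_eq_of_segment; first exact: ltW.
move=> s /andP[]; rewrite le_eqVlt => /predU1P[<-//|ps].
rewrite le_eqVlt => /predU1P[->//|sq].
by apply: contrapT => nS; apply: nex; exists s; rewrite ?ps.
Qed.

(** Sorted points of three different components are separated by points outside [S], which gives the
    forbidden alternation of five times. *)
Lemma components_le2 S :
  (forall t1 s1 t2 s2 t3, t1 < s1 -> s1 < t2 -> t2 < s2 -> s2 < t3 ->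
     S t1 -> S t2 -> S t3 -> ~ S s1 -> ~ S s2 -> False) ->
  (components S #<= `I_2)%card.
Proof.
move=> noalt; pose cc := connected_component S.
have sorted3 p q r : p < q -> q < r -> S p -> S q -> S r ->
    cc p <> cc q -> cc q <> cc r -> False.
  move=> pq qr Sp Sq Sr /(component_gap pq Sp Sq)[s1 /andP[ps1 s1q] n1].
  move=> /(component_gap qr Sq Sr)[s2 /andP[qs2 s2r] n2].
  exact: noalt ps1 s1q qs2 s2r Sp Sq Sr n1 n2.
have three p q r : S p -> S q -> S r ->
    cc p <> cc q -> cc q <> cc r -> cc p <> cc r -> False.
  move=> Sp Sq Sr npq nqr npr.
  have [pq|qp|E] := ltgtP p q; last by apply: npq; rewrite E.
  - have [qr|rq|E] := ltgtP q r; last by apply: nqr; rewrite E.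
      exact: sorted3 pq qr Sp Sq Sr npq nqr.
    have [pr|rp|E] := ltgtP p r; last by apply: npr; rewrite E.
      exact: sorted3 pr rq Sp Sr Sq npr (nesym nqr).
    exact: sorted3 rp pq Sr Sp Sq (nesym npr) npq.
  - have [pr|rp|E] := ltgtP p r; last by apply: npr; rewrite E.
      exact: sorted3 qp pr Sq Sp Sr (nesym npq) npr.
    have [qr|rq|E] := ltgtP q r; last by apply: nqr; rewrite E.
      exact: sorted3 qr rp Sq Sr Sp nqr (nesym npr).
    exact: sorted3 rq qp Sr Sq Sp (nesym nqr) (nesym npq).
(* [C1] and [C2] may coincide, so one bound serves zero, one or two components. *)
have cover C1 C2 : components S `<=` [set C1; C2] -> (components S #<= `I_2)%card.
  move=> sub; pose F (n : nat) := if n == 0%N then C1 else C2.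
  apply: card_le_trans (card_image_le F `I_2); apply: subset_card_le.
  by move=> C /sub[->|->]; [exists 0%N|exists 1%N].
have [[p Sp]|nS] := pselect (exists p, S p); last first.
  by apply: (cover set0 set0) => C [p Sp]; case: nS; exists p.
have [[q Sq npq]|all_eq] := pselect (exists2 q, S q & cc p <> cc q); last first.
  apply: (cover (cc p) (cc p)) => C [q Sq <-]; left.
  by apply: contrapT => ne; apply: all_eq; exists q => //; exact: nesym.
apply: (cover (cc p) (cc q)) => C [r Sr <-].
apply: contrapT => /not_orP[rp rq].
exact: three Sp Sq Sr npq (nesym rq) (nesym rp).
Qed.

End Components.

(** * Excursions of a taut curve from a cell *)

Section TautCells.
Variables (R : realType) (f : {poly R}).

(** One formula for all four kinds of cells: [J] is a singleton or an open gap, and [on] selects the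
    graph or the part strictly below it. *)
Definition cell_over (J : set R) (on : bool) : set (R * R) :=
  [set p | J p.1 /\ if on then p.2 = f.[p.1] else p.2 < f.[p.1]].

Definition tame_base (J : set R) : Prop :=
  (exists z, J = [set z]) \/
  [/\ open J, is_interval J & (forall z, J z -> 0 <= f^`()^`().[z]) \/
                              (forall z, J z -> f^`()^`().[z] < 0)].

Variables x y : R -> R.
Hypotheses (cx : continuous x) (cy : continuous y).
Hypothesis below : forall t, y t <= f.[x t].
Hypothesis taut : forall s r t, s <= r -> r <= t ->
  (forall l, 0 <= l <= 1 ->
     (1 - l) * y s + l * y t <= f.[(1 - l) * x s + l * x t]) ->
  combination x y s t r.

(** Over a single abscissa, on a convex arc and in a concave region, already the excursion at [s1]
    is impossible. The other two kinds need the whole pattern: contacts at [s1] and [s2] over a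
    convex gap force one at [t2], and a contact at [t2] over a concave gap means that the curve has
    rested there since [t1] or will rest until [t3]. *)
Lemma taut_cell_over J on t1 s1 t2 s2 t3 : tame_base J ->
  t1 < s1 -> s1 < t2 -> t2 < s2 -> s2 < t3 ->
  cell_over J on (x t1, y t1) -> cell_over J on (x t2, y t2) ->
  cell_over J on (x t3, y t3) ->
  cell_over J on (x s1, y s1) \/ cell_over J on (x s2, y s2).
Proof.
move=> tJ /ltW t1s1 /ltW s1t2 /ltW t2s2 /ltW s2t3 [/= J1 c1] [/= J2 c2] [/= J3 c3].
have [s1t3 t1t2 t2t3] : [/\ s1 <= t3, t1 <= t2 & t2 <= t3].
  by split; [apply: le_trans s2t3; exact: le_trans t2s2|exact: le_trans s1t2|
    exact: le_trans s2t3].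
have t1s2 := le_trans t1t2 t2s2.
case: tJ => [[z Jz]|[oJ iJ tame]].
  left; subst J; have E : x t1 = x t2 by rewrite [x t1]J1 J2.
  have [l [/andP[l0 l1] ex ey]] := taut_vertical below taut t1s1 s1t2 E.
  have xs1 : x s1 = z by rewrite ex J1 J2; ring.
  split=> //=; rewrite xs1 ey; rewrite J1 in c1; rewrite J2 in c2.
  case: on c1 c2 c3 => [-> -> _|c1 c2 _]; first by ring.
  (* The split tells [nra] which of the two weights is bounded away from 0. *)
  have [h|h] := leP l (1 / 2); last by nra.
  by nra.
have Js1 : J (x s1) by exact: (taut_interval cx below taut iJ t1s1 s1t2).
have Js2 : J (x s2) by exact: (taut_interval cx below taut iJ t2s2 s2t3).
case: tame => f2; case: on c1 c2 c3 => c1 c2 c3.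
- left; split=> //.
  exact: (taut_convex_contact cx cy below taut iJ f2 t1s1 s1t2).
- apply: contrapT => /not_orP[n1 n2].
  have ctc s : J (x s) -> ~ cell_over J false (x s, y s) -> y s = f.[x s].
    move=> Js ns; apply: le_anti; rewrite below leNgt; apply/negP => lts.
    by apply: ns; split.
  have := taut_convex_contact cx cy below taut iJ f2 s1t2 t2s2 Js1 Js2
    (ctc _ Js1 n1) (ctc _ Js2 n2).
  by move=> E; rewrite E ltxx in c2.
- have [[ex ey]|[ex ey]] :=
    taut_concave_contact cx cy below taut oJ iJ f2 t1t2 t2t3 J2 c2.
    left; have [e1 e2] := taut_const below taut t1s1 s1t2 ex ey.
    by split=> //=; rewrite e1 e2.
  right; have [e1 e2] := taut_const below taut t2s2 s2t3 (esym ex) (esym ey).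
  by split=> //=; rewrite e1 e2.
- left; split=> //=; rewrite lt_neqAle below andbT; apply/eqP => cs1.
  have [[ex ey]|[ex ey]] :=
    taut_concave_contact cx cy below taut oJ iJ f2 t1s1 s1t2 Js1 cs1.
    by move: c1; rewrite ex ey cs1 ltxx.
  by move: c2; rewrite ex ey cs1 ltxx.
Qed.

End TautCells.

(** * The cell decomposition *)

Section Cells.
Variables (R : realType) (f : {poly R}).

(** [psi] is total and its continuity at points of [J] is taken in the whole line, so that it
    composes directly with the projection from the plane. *)
Definition line_like (J : set R) : Prop := exists phi psi : R -> R,
  [/\ continuous phi, (forall z, J z -> {for z, continuous psi}),
      (forall t, J (phi t)), cancel phi psi &
      (forall z, J z -> phi (psi z) = z)].

Lemma continuous_row (T : topologicalType) n (u : 'I_n -> T -> R) (p : T) :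
  (forall i, {for p, continuous (u i)}) ->
  {for p, continuous (fun q => \row_i u i q)}.
Proof.
move=> cu A [P nP PA].
have : \forall q \near p, forall i : 'I_n, P 0 i (u i q).
  by apply: filter_forall => i; apply: (cu i); have := nP 0 i; rewrite mxE.
by apply: filterS => q Pq; apply: PA => i j; rewrite (ord1 i) mxE.
Qed.

Lemma continuous_pair (T : topologicalType) (u v : T -> R) (p : T) :
  {for p, continuous u} -> {for p, continuous v} ->
  {for p, continuous (fun q => (u q, v q))}.
Proof. by move=> cu cv; exact: (cvg_pair cu cv). Qed.

Let fst_continuous (p : R * R) : {for p, continuous (@fst R R)}.
Proof. exact: cvg_fst. Qed.

Let snd_continuous (p : R * R) : {for p, continuous (@snd R R)}.
Proof. exact: cvg_snd. Qed.

(** The logarithm of the depth below the graph straightens each open vertical ray to a line; the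
    inverse subtracts an exponential from the boundary height. *)
Let ln_depth_continuous (p : R * R) : p.2 < f.[p.1] ->
  {for p, continuous (fun q : R * R => ln (f.[q.1] - q.2))}.
Proof.
move=> pf; have c : {for p, continuous (fun q : R * R => f.[q.1] - q.2)}.
  apply: cvgB; last exact: snd_continuous.
  exact: (continuous_comp (@fst_continuous p) (@continuous_horner R f p.1)).
apply: (continuous_comp c); apply: continuous_ln; by rewrite subr_gt0.
Qed.

Lemma is_cell_point z : is_cell 0 (cell_over f [set z] true).
Proof.
exists (fun=> (z, f.[z])), (fun=> 0); split.
- exact: cst_continuous.
- by apply: continuous_subspaceT; exact: cst_continuous.
- by [].
- by move=> v; apply/rowP => -[].
- by case=> a b [/= -> ->].
Qed.

Lemma is_cell_ray z : is_cell 1 (cell_over f [set z] false).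
Proof.
exists (fun v => (z, f.[z] - expR (v 0 0))),
  (fun p => \row_i ln (f.[p.1] - p.2)); split.
- move=> v.
  have c := continuous_comp (@coord_continuous R _ _ 0 0 v) (@continuous_expR R (v 0 0)).
  have cst1 (w : R) := @cst_continuous 'rV[R]_1 R w v.
  exact: (continuous_pair (cst1 z) (continuousB (cst1 f.[z]) c)).
- apply: continuous_in_subspaceT => p; rewrite inE => -[_ pf].
  by apply: (@continuous_row _ 1 (fun=> fun p => ln (f.[p.1] - p.2))) => i;
    exact: ln_depth_continuous.
- by move=> v; split=> //=; rewrite gtrDl oppr_lt0 expR_gt0.
- by move=> v; apply/rowP => i; rewrite mxE/= opprB addrC subrK expRK (ord1 i).
- case=> a b [/= -> bf]; rewrite mxE lnK ?posrE ?subr_gt0//; congr pair; ring.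
Qed.

Lemma is_cell_arc J : line_like J -> is_cell 1 (cell_over f J true).
Proof.
move=> [phi [psi [cphi cpsi Jphi phiK psiK]]].
exists (fun v => (phi (v 0 0), f.[phi (v 0 0)])), (fun p => \row_i psi p.1); split.
- move=> v.
  have c := continuous_comp (@coord_continuous R _ _ 0 0 v) (@cphi (v 0 0)).
  exact: (continuous_pair c (continuous_comp c (@continuous_horner R f _))).
- apply: continuous_in_subspaceT => p; rewrite inE => -[Jp _].
  apply: (@continuous_row _ 1 (fun=> fun p => psi p.1)) => i.
  exact: (continuous_comp (@fst_continuous p) (cpsi _ Jp)).
- by move=> v; split=> //=.
- by move=> v; apply/rowP => i; rewrite mxE/= phiK (ord1 i).
- by case=> a b [/= Ja ->]; rewrite mxE psiK.
Qed.

Lemma is_cell_region J : line_like J -> is_cell 2 (cell_over f J false).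
Proof.
move=> [phi [psi [cphi cpsi Jphi phiK psiK]]].
exists (fun v => (phi (v 0 0), f.[phi (v 0 0)] - expR (v 0 1))),
  (fun p => \row_(i < 2) if i == 0 then psi p.1 else ln (f.[p.1] - p.2)); split.
- move=> v.
  have c := continuous_comp (@coord_continuous R _ _ 0 0 v) (@cphi (v 0 0)).
  have c' := continuous_comp (@coord_continuous R _ _ 0 1 v) (@continuous_expR R (v 0 1)).
  exact: (continuous_pair c (continuousB (continuous_comp c (@continuous_horner R f _)) c')).
- apply: continuous_in_subspaceT => p; rewrite inE => -[Jp pf].
  apply: (@continuous_row _ 2
    (fun i p => if i == 0 then psi p.1 else ln (f.[p.1] - p.2))) => i.
  case: (i == 0); last exact: ln_depth_continuous.
  exact: (continuous_comp (@fst_continuous p) (cpsi _ Jp)).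
- by move=> v; split=> //=; rewrite gtrDl oppr_lt0 expR_gt0.
- move=> v; apply/rowP => i; rewrite mxE/= phiK opprB addrC subrK expRK.
  have [->//|i0] := eqVneq i 0; congr (v 0 _).
  by apply/val_inj; case: i i0 => [[|[|]]].
- case=> a b [/= Ja bf]; rewrite !mxE/= psiK// lnK ?posrE ?subr_gt0//.
  by congr pair; ring.
Qed.

(** * Subdivision of the line at the roots of the second derivative *)

Definition gap (lr : option R * option R) : set R :=
  [set z | (if lr.1 is Some p then p < z else True) /\
           (if lr.2 is Some q then z < q else True)].

Lemma gap_open lr : open (gap lr).
Proof.
case: lr => l r; apply: openI.
  by case: l => [p|]; [exact: open_gt|exact: openT].
by case: r => [q|]; [exact: open_lt|exact: openT].
Qed.

Lemma gap_interval lr : is_interval (gap lr).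
Proof.
case: lr => l r u v [/= lu ur] [/= lv vr] z /andP[uz zv]; split=> /=.
  by case: l lu lv => // p lu _; exact: lt_le_trans uz.
by case: r ur vr => // q _ vr; exact: le_lt_trans vr.
Qed.

Lemma gap_line_like lr : gap lr !=set0 -> line_like (gap lr).
Proof.
case: lr => [[p|] [q|]] [w [/= pw wq]].
- have pq : 0 < q - p by rewrite subr_gt0 (lt_trans pw).
  (* A decreasing logistic map of the line onto ]p, q[, with its inverse. *)
  exists (fun t => p + (q - p) / (1 + expR t)),
    (fun z => ln ((q - p) / (z - p) - 1)).
  have e1 t : 0 < 1 + expR t by rewrite addr_gt0// expR_gt0.
  split.
  + move=> t; apply: cvgD; first exact: cvg_cst.
    apply: cvgMr; apply: cvgV; first by rewrite gt_eqF.
    by apply: cvgD; [exact: cvg_cst|exact: continuous_expR].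
  + move=> z [/= pz zq].
    have c : {for z, continuous (fun z => (q - p) / (z - p) - 1)}.
      apply: cvgB; last exact: cvg_cst.
      apply: cvgMr; apply: cvgV; first by rewrite subr_eq0 gt_eqF.
      by apply: cvgB; [exact: cvg_id|exact: cvg_cst].
    apply: (continuous_comp c); apply: continuous_ln.
    by rewrite subr_gt0 ltr_pdivlMr ?subr_gt0// mul1r ltrD2r.
  + move=> t; split=> /=; first by rewrite ltrDl divr_gt0.
    by rewrite -ltrBrDl ltr_pdivrMr// mulrDr mulr1 ltrDl mulr_gt0// expR_gt0.
  + move=> t /=; rewrite [p + _ - p]addrAC subrr add0r invf_div mulrC divfK ?gt_eqF//.
    by rewrite [1 + _]addrC addrK expRK.
  + move=> z [/= pz zq]; rewrite lnK; last first.
      by rewrite posrE subr_gt0 ltr_pdivlMr ?subr_gt0// mul1r ltrD2r.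
    rewrite [1 + _]addrC subrK invf_div mulrC divfK ?gt_eqF//.
    by rewrite addrC subrK.
- exists (fun t => p + expR t), (fun z => ln (z - p)); split.
  + by move=> t; apply: cvgD; [exact: cvg_cst|exact: continuous_expR].
  + move=> z [/= pz _].
    have c : {for z, continuous (fun z => z - p)}.
      by apply: cvgB; [exact: cvg_id|exact: cvg_cst].
    by apply: (continuous_comp c); apply: continuous_ln; rewrite subr_gt0.
  + by move=> t; split=> //=; rewrite ltrDl expR_gt0.
  + by move=> t; rewrite addrAC subrr add0r expRK.
  + by move=> z [/= pz _]; rewrite lnK ?posrE ?subr_gt0// addrC subrK.
- exists (fun t => q - expR t), (fun z => ln (q - z)); split.
  + by move=> t; apply: cvgB; [exact: cvg_cst|exact: continuous_expR].
  + move=> z [/= _ zq].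
    have c : {for z, continuous (fun z => q - z)}.
      by apply: cvgB; [exact: cvg_cst|exact: cvg_id].
    by apply: (continuous_comp c); apply: continuous_ln; rewrite subr_gt0.
  + by move=> t; split=> //=; rewrite gtrDl oppr_lt0 expR_gt0.
  + by move=> t; rewrite opprB addrC subrK expRK.
  + by move=> z [/= _ zq]; rewrite lnK ?posrE ?subr_gt0// opprB addrC subrK.
- by exists id, id; split=> // *; exact: cvg_id.
Qed.

(** The first conjunct empties the set when f'' = 0, where every point would be a root. Roots
    without change of sign are kept. *)
Definition inflections : set R :=
  [set z | f^`()^`() != 0 /\ root f^`()^`() z].

Definition endpoints : set (option R) := [set None] `|` Some @` inflections.

(** The roots are not sorted: all intervals with ends among them or infinite are candidates, and the
    nonempty root-free ones are the gaps. *)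
Definition bases : set (set R) :=
  [set [set z] | z in inflections] `|`
  [set J | [/\ (gap @` (endpoints `*` endpoints)) J, J !=set0
             & forall z, inflections z -> ~ J z]].

Lemma inflections_finite : finite_set inflections.
Proof.
have [f0|f0] := eqVneq f^`()^`() 0.
  by apply: (@sub_finite_set _ _ set0) => // z [/negP]; rewrite f0 eqxx.
apply: (sub_finite_set _ (finite_seq (rootsR f^`()^`()))) => z [_ rz] /=.
by rewrite -(roots_on_rootsR f0) rz andbT in_itv.
Qed.

Lemma bases_finite : finite_set bases.
Proof.
have fe : finite_set endpoints.
  by rewrite finite_setU; split=> //; apply: finite_image; exact: inflections_finite.
rewrite finite_setU; split; first by apply: finite_image; exact: inflections_finite.
apply: (@sub_finite_set _ _ (gap @` (endpoints `*` endpoints))).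
  by move=> J [].
by apply: finite_image; exact: finite_setX.
Qed.

(** If two root-free gaps share a point, a finite end of one is a root and cannot lie inside the
    other; [gap_sub] gives one inclusion, symmetry the other. *)
Lemma bases_disjoint J J' z : bases J -> bases J' -> J z -> J' z -> J = J'.
Proof.
have gap_sub lr lr' (w : R) : (endpoints `*` endpoints) lr ->
    (forall z, inflections z -> ~ gap lr' z) -> gap lr w -> gap lr' w ->
    gap lr' `<=` gap lr.
  case: lr => l r; case: lr' => l' r' [/= el er] n [/= lw wr] [/= lw' wr'] u [/= l'u ur'].
  split=> /=.
    case: l el lw => // p [//|[p' Zp [<-]]] pw.
    rewrite ltNge; apply/negP => up; apply: (n p' Zp); split=> /=.
      by case: l' l'u {lw' n} => // q qu; exact: lt_le_trans up.
    by case: r' wr' {ur' n} => // q wq; exact: lt_trans pw wq.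
  case: r er wr => // p [//|[p' Zp [<-]]] wp.
  rewrite ltNge; apply/negP => pu; apply: (n p' Zp); split=> /=.
    by case: l' lw' {l'u n} => // q qw; exact: lt_trans qw wp.
  by case: r' ur' {wr' n} => // q uq; exact: le_lt_trans pu uq.
move=> [[a Za <-]|[[lr elr <-] _ n]] [[b Zb <-]|[[lr' elr' <-] _ n']] /=.
- by move=> -> ->.
- by move=> -> /(n' _ Za).
- by move=> + zb; rewrite zb => /(n _ Zb).
- move=> h h'; apply/seteqP; split; [exact: (gap_sub lr' lr z)|exact: (gap_sub lr lr' z)].
Qed.

Lemma finite_extrema (Z : set R) : finite_set Z -> Z !=set0 ->
  (exists2 m, Z m & forall z, Z z -> z <= m) /\
  (exists2 m, Z m & forall z, Z z -> m <= z).
Proof.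
move=> /finite_compact cZ Z0.
have cid : {within Z, continuous (@id R)}.
  by apply: continuous_subspaceT => ?; exact: cvg_id.
have [M + hM] := compact_EVT_max Z0 cZ cid; have [m + hm] := compact_EVT_min Z0 cZ cid.
rewrite !inE => Zm ZM; split; [exists M|exists m] => // z Zz.
  by apply: hM; rewrite inE.
by apply: hm; rewrite inE.
Qed.

Lemma bases_cover z : exists2 J, bases J & J z.
Proof.
have [Zz|nZz] := pselect (inflections z).
  by exists [set z] => //; left; exists z.
have fZ (P : set R) : finite_set (inflections `&` P).
  exact: sub_finite_set (@subIsetl _ _ _) inflections_finite.
(* [None] asserts that no root lies on this side, hence the default [false] in the last clause. *)
have [l [el lz hl]] : exists l, [/\ endpoints l,
    if l is Some p then p < z else True
    & forall w, inflections w -> w < z -> if l is Some p then w <= p else false].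
  have [[w [Zw wz]]|no] := pselect (inflections `&` [set w | w < z] !=set0).
    have [[m [Zm mz] mmax] _] := finite_extrema (fZ _) (ex_intro _ w (conj Zw wz)).
    exists (Some m); split=> //; first by right; exists m.
    by move=> u Zu uz; apply: mmax.
  exists None; split=> //; first by left.
  by move=> u Zu uz; case: no; exists u.
have [r [er zr hr]] : exists r, [/\ endpoints r,
    if r is Some p then z < p else True
    & forall w, inflections w -> z < w -> if r is Some p then p <= w else false].
  have [[w [Zw wz]]|no] := pselect (inflections `&` [set w | z < w] !=set0).
    have [_ [m [Zm mz] mmin]] := finite_extrema (fZ _) (ex_intro _ w (conj Zw wz)).
    exists (Some m); split=> //; first by right; exists m.
    by move=> u Zu uz; apply: mmin.
  exists None; split=> //; first by left.
  by move=> u Zu uz; case: no; exists u.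
exists (gap (l, r)); last by [].
right; split; [by exists (l, r)|by exists z|].
move=> w Zw [/= lw wr]; have [wz|zw|E] := ltgtP w z.
- have := hl w Zw wz; case: l lw {el lz hl} => // p pw; rewrite leNgt => /negP; exact.
- have := hr w Zw zw; case: r wr {er zr hr} => // p pw; rewrite leNgt => /negP; exact.
- by rewrite E in Zw.
Qed.

(** A sign change of f'' inside a gap would produce a root there by the intermediate value theorem.
    The case f'' = 0 is set apart because its roots are not cut out. *)
Lemma bases_tame J : bases J -> tame_base f J.
Proof.
move=> [[z _ <-]|[[lr _ <-] _ n]]; first by left; exists z.
right; split; [exact: gap_open|exact: gap_interval|].
have [f0|f0] := eqVneq f^`()^`() 0.
  by left=> z _; rewrite f0 horner0.
have [|/existsNP[z /not_implyP[Jz /negP]]] :=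
  pselect (forall z, gap lr z -> 0 <= f^`()^`().[z]); first by left.
rewrite -ltNge => fz; right => w Jw; rewrite ltNge; apply/negP => fw.
have [u uzw fu] : exists2 u, gap lr u & root f^`()^`() u.
  have [zw|/ltW wz] := leP z w.
    have [|u + fu] := polyrcf.poly_ivt (p := f^`()^`()) zw.
      by rewrite mulr_le0_ge0// ltW.
    rewrite in_itv/= => /andP[zu uw]; exists u => //.
    by apply: (gap_interval Jz Jw); rewrite zu.
  have [|u + fu] := polyrcf.poly_ivt (p := f^`()^`()) wz.
    by rewrite mulr_ge0_le0// ltW.
  rewrite in_itv/= => /andP[wu uz]; exists u => //.
  by apply: (gap_interval Jw Jz); rewrite wu.
by apply: (n u).
Qed.

Lemma bases_cell J on : bases J -> exists2 d, (d <= 2)%N & is_cell d (cell_over f J on).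
Proof.
move=> [[z _ <-]|[[lr _ <-] ne _]].
  case: on; first by exists 0%N => //; exact: is_cell_point.
  by exists 1%N => //; exact: is_cell_ray.
have ll := gap_line_like ne.
case: on; first by exists 1%N => //; exact: is_cell_arc.
by exists 2%N => //; exact: is_cell_region.
Qed.

Definition subgraph_cells : set (set (R * R)) :=
  [set cell_over f J.1 J.2 | J in bases `*` [set: bool]].

Lemma subgraph_cells_decomposition :
  cell_decomposition [set p : R * R | p.2 <= f.[p.1]] subgraph_cells.
Proof.
have fin : finite_set subgraph_cells.
  by apply: finite_image; apply: finite_setX; [exact: bases_finite|exact: finite_finset].
split.
- exact: finite_set_countable.
- by move=> e [[J on] [/= bJ _] <-]; exact: bases_cell.
- move=> e1 e2 [[J on] [/= bJ _] <-] [[J' on'] [/= bJ' _] <-] [p [[/= Jp o] [/= Jp' o']]].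
  rewrite (bases_disjoint bJ bJ' Jp Jp'); congr cell_over.
  by case: on on' o o' => -[]// => [-> |+ E]; rewrite ?E ltxx.
- apply/seteqP; split=> p /=.
    rewrite le_eqVlt => /predU1P pf; have [J bJ Jp] := bases_cover p.1.
    by case: pf => pf; [exists (cell_over f J true)|exists (cell_over f J false)] => //;
      [exists (J, true)|exists (J, false)].
  by move=> [e [[J on] _ <-] [/= _]]; case: on => [->|/ltW].
(* The closure condition holds because there are finitely many cells altogether. *)
- by move=> e _; apply: sub_finite_set fin => e' [].
Qed.

End Cells.

(** * The interaction bound for shortest curves below a polynomial graph *)

Theorem theorem2p10 (R : realType) (f : {poly R}) :
  exists C : set (set (R * R)),
    cell_decomposition [set p : R * R | p.2 <= f.[p.1]] C /\
    forall (A B : R * R) (g : R -> R * R) (a b : R),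
      [set p : R * R | p.2 <= f.[p.1]] A ->
      [set p : R * R | p.2 <= f.[p.1]] B ->
      shortest_curve [set p : R * R | p.2 <= f.[p.1]] A B g a b ->
      forall e, C e ->
        interacts_finitely g a b e /\
        ((is_cell 0 e \/ is_cell 1 e) -> interacts_at_most g a b e 2).
Proof.
exists (subgraph_cells f); split; first exact: subgraph_cells_decomposition.
move=> A B g a b _ _ sg _ [[J on] [/= bJ _] <-].
have [[ab /piecesP/pieces_clamp_continuous[cx cy] gX _ _] _] := sg.
(* The clamped curve agrees with [g] on [a, b]; as [clamp] is monotone, it inherits the chord
   property at all real times. *)
pose x t := (g (clamp a b t)).1; pose y t := (g (clamp a b t)).2.
have below t : y t <= f.[x t] by apply: gX; exact: clamp_in.
have taut s r t : s <= r -> r <= t -> (forall l, 0 <= l <= 1 ->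
    (1 - l) * y s + l * y t <= f.[(1 - l) * x s + l * x t]) ->
    combination x y s t r.
  move=> sr rt segX.
  have /andP[as_ _] := clamp_in s ab; have /andP[_ tb] := clamp_in t ab.
  apply: (shortest_on_segment sg as_ (clamp_le a b sr) (clamp_le a b rt) tb).
  by move=> q [l [l01 /= -> ->]]; exact: segX.
have le2 : (components (curve_preimage g a b (cell_over f J on)) #<= `I_2)%card.
  apply: components_le2 => t1 s1 t2 s2 t3 h1 h2 h3 h4 [i1 c1] [i2 c2] [i3 c3] n1 n2.
  have E t : a <= t <= b -> g t = (x t, y t).
    by move=> tab; rewrite /x /y clamp_id// -surjective_pairing.
  have /andP[at1 _] := i1; have /andP[_ t3b] := i3.
  have j1 : a <= s1 <= b.
    rewrite (le_trans at1 (ltW h1))/=; apply: le_trans t3b.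
    by rewrite ltW// (lt_trans h2)// (lt_trans h3).
  have j2 : a <= s2 <= b.
    rewrite (le_trans _ t3b) ?(ltW h4)// andbT; apply: le_trans at1 _.
    by rewrite ltW// (lt_trans h1)// (lt_trans h2).
  rewrite !E// in c1 c2 c3.
  have [c|c] := taut_cell_over cx cy below taut (bases_tame bJ) h1 h2 h3 h4 c1 c2 c3.
    by apply: n1; split=> //; rewrite E.
  by apply: n2; split=> //; rewrite E.
split=> [|_]; last exact: le2.
exact: card_le_finite le2 (finite_II 2).
Qed.
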